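(* Let $G$ be a connected graph of order $n\ge 2$ and let $H$ be a non-trivial graph. If there exists an adjacency basis for $H$ which is also a dominating set of $H$, and if for every adjacency basis $S$ for $H$ there exists $v\in V(H)\setminus S$ such that $S\subseteq N_H(v)$, then $$\operatorname{dim}_A(G\odot H)=n\cdot \operatorname{dim}_A(H)+\gamma(G).$$
   Context: All graphs are finite, simple, undirected; non-trivial means order at least 2. A set $S\subseteq V(H)$ is an adjacency generator for $H$ if for every two distinct $x,y\in V(H)\setminus S$ there exists $s\in S$ with $|N_H(s)\cap\{x,y\}|=1$ ($N_H$ the open neighbourhood); an adjacency basis is an adjacency generator of minimum cardinality, and this cardinality is $\operatorname{dim}_A(H)$. A dominating set $D$ of a graph satisfies $\bigcup_{v\in D}N[v]=V$; $\gamma(G)$ is the minimum size of a dominating set of $G$. The corona product $G\odot H$ ($G$ of order $n$ with vertices $v_1,\dots,v_n$) consists of $G$ and $n$ disjoint copies $H_1,\dots,H_n$ of $H$, with $v_i$ joined to every vertex of $H_i$. *)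

(* Defs.v *)
From mathcomp Require Import all_boot.

Set Implicit Arguments.
Unset Strict Implicit.
Unset Printing Implicit Defensive.

Record sgraph := SGraph {
  vertex :> finType;
  adj : rel vertex;
  adj_sym : symmetric adj;
  adj_irrefl : irreflexive adj
}.

Definition graph_order (G : sgraph) : nat := #|vertex G|.

(* Non-emptiness is not required here. *)
Definition connected (G : sgraph) : Prop :=
  forall x y : G, connect (@adj G) x y.

Definition open_nbh (G : sgraph) (v : G) : {set G} := [set u | adj v u].

Definition closed_nbh (G : sgraph) (v : G) : {set G} := v |: open_nbh v.

Definition adj_generator (G : sgraph) (S : {set G}) : bool :=
  [forall x : G, forall y : G,
     [&& x \notin S, y \notin S & x != y] ==>
     [exists s in S, #|open_nbh s :&: [set x; y]| == 1]].

Definition adj_basis (G : sgraph) (S : {set G}) : bool :=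
  adj_generator S && [forall T : {set G}, adj_generator T ==> (#|S| <= #|T|)].

(* [setT] only seeds the minimum: it is always an adjacency generator (see
   [adj_generatorT]), so that the arg min is an adjacency basis. *)
Definition dimA (G : sgraph) : nat :=
  #|[arg min_(S < [set: G] | adj_generator S) #|S| ]|.

Definition dominating (G : sgraph) (D : {set G}) : bool :=
  \bigcup_(v in D) closed_nbh v == [set: G].

Definition domination_number (G : sgraph) : nat :=
  #|[arg min_(D < [set: G] | dominating D) #|D| ]|.

Lemma adj_generatorT (G : sgraph) : adj_generator [set: G].
Proof. by apply/forallP=> x; apply/forallP=> y; rewrite inE. Qed.

Lemma dominatingT (G : sgraph) : dominating [set: G].
Proof.
apply/eqP/setP=> x; rewrite inE; apply/bigcupP.
by exists x; rewrite ?inE ?eqxx.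
Qed.

Lemma adj_basisE (G : sgraph) (S : {set G}) :
  adj_basis S = adj_generator S && (#|S| == dimA G).
Proof.
rewrite /adj_basis /dimA; case: arg_minnP => [|B genB minB].
  exact: adj_generatorT.
case genS: (adj_generator S) => //=; apply/forallP/eqP => [minS|-> T].
  apply/eqP; rewrite eqn_leq minB // andbT.
  by have /implyP := minS B; apply.
by apply/implyP=> /minB.
Qed.

Lemma dimA_basis (G : sgraph) : exists2 S : {set G}, adj_basis S & #|S| = dimA G.
Proof.
have: exists2 S : {set G}, adj_generator S & #|S| = dimA G.
  rewrite /dimA; case: arg_minnP => [|B genB _]; first exact: adj_generatorT.
  by exists B.
by case=> S genS cardS; exists S; rewrite // adj_basisE genS cardS eqxx.
Qed.

Lemma domination_numberP (G : sgraph) :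
  (exists2 D : {set G}, dominating D & #|D| = domination_number G) /\
  (forall D : {set G}, dominating D -> domination_number G <= #|D|).
Proof.
rewrite /domination_number; case: arg_minnP => [|D domD minD].
  exact: dominatingT.
by split; first by exists D.
Qed.

Section Corona.

Variables G H : sgraph.

(* [inl v] is the vertex v of G; [inr (v, x)] is the vertex x in the copy of H
   attached to v. *)
Definition corona_adj (a b : G + G * H) : bool :=
  match a, b with
  | inl u, inl v => adj u v
  | inl u, inr (v, _) => u == v
  | inr (u, _), inl v => u == v
  | inr (u, x), inr (v, y) => (u == v) && adj x y
  end.

Lemma corona_adj_sym : symmetric corona_adj.
Proof.
move=> [u|[u x]] [v|[v y]] //=; try exact: eq_sym; first exact: adj_sym.
by rewrite eq_sym adj_sym.
Qed.

Lemma corona_adj_irrefl : irreflexive corona_adj.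
Proof. by move=> [u|[u x]] /=; rewrite adj_irrefl ?andbF. Qed.

Definition corona : sgraph := SGraph corona_adj_sym corona_adj_irrefl.

End Corona.

(* Main.v *)
Require Import Defs.
From mathcomp Require Import all_boot.

(** Write B_v for the trace of a set B on the copy of H at v.  If B is an
adjacency generator of the corona, each B_v is one of H, so |B_v| >= dim_A(H).
If v is not in B and B_v is a basis, take x outside B_v with B_v inside N(x):
only a neighbour of v in G can distinguish x from v, so the vertices v of G
that lie in B or have |B_v| > dim_A(H) form a dominating set.  Conversely, a
minimum dominating set of G together with a copy at each vertex of a dominating
adjacency basis of H is an adjacency generator of the corona. *)

(** For [x != y], the number of neighbours of [s] in [{x, y}] is the sum of the bits [adj s x] and
    [adj s y], so it is 1 exactly when they differ. *)
Lemma adj_generatorP (G : sgraph) (S : {set G}) :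
  reflect (forall x y, x \notin S -> y \notin S -> x != y ->
             exists2 s, s \in S & adj s x != adj s y)
          (adj_generator S).
Proof.
have cardE (s x y : G) : x != y ->
    (#|open_nbh s :&: [set x; y]| == 1) = (adj s x != adj s y).
  move=> xy; rewrite setIUr cardsU setIACA setIid.
  have /setP-> : [set x] :&: [set y] =i set0.
    by move=> z; rewrite !inE; case: eqP => // ->; rewrite (negPf xy).
  rewrite setI0 cards0 subn0.
  have c1 z : #|open_nbh s :&: [set z]| = adj s z.
    case sz: (adj s z).
      by rewrite (setIidPr _) ?cards1 // sub1set inE.
    apply/eqP; rewrite cards_eq0 setI_eq0 disjoint_sym disjoints1.
    by rewrite inE sz.
  by rewrite !c1; do 2!case: adj.
apply: (iffP forallP) => [gen x y xS yS xy | gen x].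
  have /forallP/(_ y) := gen x; rewrite xS yS xy => /exists_inP[s sS].
  by rewrite cardE //; exists s.
apply/forallP=> y; apply/implyP=> /and3P[xS yS xy].
have [s sS d] := gen x y xS yS xy.
by apply/exists_inP; exists s; rewrite ?cardE.
Qed.

Lemma dominatingP (G : sgraph) (D : {set G}) :
  reflect (forall x, x \notin D -> exists2 d, d \in D & adj d x) (dominating D).
Proof.
apply: (iffP eqP) => [dom x xD | dom].
  have : x \in [set: G] by rewrite inE.
  rewrite -dom => /bigcupP[d dD]; rewrite !inE => /orP[/eqP xd|].
    by rewrite xd dD in xD.
  by exists d.
apply/setP=> x; rewrite inE; apply/bigcupP.
have [xD|/dom[d dD dx]] := boolP (x \in D).
  by exists x; rewrite // !inE eqxx.
by exists d; rewrite // !inE dx orbT.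
Qed.

Lemma dimA_leq (G : sgraph) (S : {set G}) : adj_generator S -> dimA G <= #|S|.
Proof.
have [B] := dimA_basis G; rewrite /adj_basis => /andP[_ /forallP minB] <-.
exact/implyP.
Qed.

Section CoronaGenerators.

Variables G H : sgraph.

Definition base_trace (B : {set corona G H}) : {set G} :=
  [set v | (inl v : corona G H) \in B].

Definition copy_trace (B : {set corona G H}) (v : G) : {set H} :=
  [set x | (inr (v, x) : corona G H) \in B].

Lemma card_corona_set (B : {set corona G H}) :
  #|B| = \sum_(v : G) ((v \in base_trace B) + #|copy_trace B v|).
Proof.
rewrite -sum1_card big_mkcond big_sumType big_split /=; congr (_ + _).
  by apply: eq_bigr => v _; rewrite inE; case: (_ \in B).
transitivity (\sum_(v : G) \sum_(x : H)
    (if (inr (v, x) : corona G H) \in B then 1 else 0)).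
  by rewrite pair_big; apply: eq_bigr => -[].
apply: eq_bigr => v _; rewrite -sum1_card [RHS]big_mkcond.
by apply: eq_bigr => x _; rewrite inE.
Qed.

(** A vertex outside the copy at [v] is adjacent to all of that copy or to none of it, so a vertex
    separating two members of the copy lies in the copy. *)
Lemma copy_trace_generator (B : {set corona G H}) (v : G) :
  adj_generator B -> adj_generator (copy_trace B v).
Proof.
move=> /adj_generatorP gen; apply/adj_generatorP=> x y; rewrite !inE => xB yB xy.
have [|[u|[u s]] sB /=] := gen (inr (v, x)) (inr (v, y)) xB yB.
- by apply: contra xy => /eqP[->].
- by rewrite eqxx.
by have [uv|] := eqVneq u v => //=; exists s; rewrite // inE -uv.
Qed.

Lemma corona_generator_dominating (B : {set corona G H}) :
  (forall S : {set H}, adj_basis S ->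
     exists2 v : H, v \notin S & S \subset open_nbh v) ->
  adj_generator B ->
  dominating [set v | (v \in base_trace B) || (dimA H < #|copy_trace B v|)].
Proof.
move=> nbh genB; apply/dominatingP=> v.
rewrite !inE negb_or -leqNgt => /andP[vB small].
have genv := copy_trace_generator _ v genB.
have /nbh[x] : adj_basis (copy_trace B v).
  by rewrite adj_basisE genv eqn_leq small dimA_leq.
rewrite inE => xB /subsetP sub.
(* Apply the generator property to [v] and [(v, x)]. A separating vertex in the copy at [v] would
   lie in the trace, hence be adjacent to both; one in another copy is adjacent to neither. *)
have [//|[u|[u s]] sB /=] := elimT (adj_generatorP _ _) genB _ _ vB xB.
  have [uv|_ uv] := eqVneq u v; first by rewrite -uv sB in vB.
  by exists u; rewrite ?inE ?sB //; case: (adj u v) uv.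
have [uv|//] := eqVneq u v.
have /sub : s \in copy_trace B v by rewrite inE -uv.
by rewrite inE adj_sym => ->.
Qed.

Definition corona_set (D : {set G}) (S : {set H}) : {set corona G H} :=
  [set a | match a with inl v => v \in D | inr p => p.2 \in S end].

Lemma card_corona_set_of (D : {set G}) (S : {set H}) :
  #|corona_set D S| = #|G| * #|S| + #|D|.
Proof.
rewrite card_corona_set big_split /= addnC; congr (_ + _).
  rewrite -sum_nat_const; apply: eq_bigr => v _.
  by apply: eq_card => x; rewrite !inE.
rewrite -sum1_card [RHS]big_mkcond; apply: eq_bigr => v _.
by rewrite !inE; case: (v \in D).
Qed.

Lemma corona_set_generator (D : {set G}) (S : {set H}) :
  0 < #|H| -> dominating D -> adj_generator S -> dominating S ->
  adj_generator (corona_set D S).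
Proof.
move=> /card_gt0P[h _] /dominatingP domD /adj_generatorP genS /dominatingP domS.
(* Any such [s0], taken in the copy at [v], separates [v] from every other vertex of [G]. *)
have [s0 s0S] : exists s, s \in S.
  by have [|/domS[s]] := boolP (h \in S); [exists h | exists s].
have mixed v u x : v \notin D -> x \notin S ->
    exists2 s, s \in corona_set D S
             & @adj (corona G H) s (inl v) != @adj (corona G H) s (inr (u, x)).
  move=> vD xS; have [->|uv] := eqVneq u v.
    have [d dD dv] := domD _ vD.
    exists (inl d); rewrite ?inE //= dv.
    by apply: contraNneq vD; case: eqP => // <-.
  have [s sS sx] := domS _ xS.
  by exists (inr (u, s)); rewrite ?inE //= eqxx sx (negPf uv).
apply/adj_generatorP=> -[v|[v x]] [u|[u y]]; rewrite !inE /= => xB yB xy.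
- exists (inr (v, s0)); rewrite ?inE //= eqxx.
  by case: eqVneq xy => // ->; rewrite eqxx.
- exact: mixed.
- by have [s sB d] := mixed u v x yB xB; exists s; rewrite // eq_sym.
have [uv|uv] := eqVneq v u.
  have [|s sS d] := genS x y xB yB.
    by apply: contra xy => /eqP->; rewrite uv.
  by exists (inr (v, s)); rewrite ?inE //= uv eqxx.
have [s sS sx] := domS _ xB.
by exists (inr (v, s)); rewrite ?inE //= eqxx sx (negPf uv).
Qed.

End CoronaGenerators.

Theorem theorem8 (G H : sgraph) (n : nat)
  (hn : graph_order G = n) (hn2 : 2 <= n) (hG : connected G) (hH : 2 <= graph_order H)
  (hdom : exists S : {set H}, adj_basis S /\ dominating S)
  (hnbh : forall S : {set H}, adj_basis S ->
     exists2 v : H, v \notin S & S \subset open_nbh v) :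
  dimA (corona G H) = n * dimA H + domination_number G.
Proof.
have [[D domD cardD] minD] := domination_numberP G.
apply/eqP; rewrite eqn_leq; apply/andP; split.
  have [S [+ domS]] := hdom; rewrite adj_basisE => /andP[genS /eqP cardS].
  rewrite -hn -cardS -cardD -card_corona_set_of.
  exact/dimA_leq/corona_set_generator/domS/genS/domD/ltnW/hH.
have [B /andP[genB _] <-] := dimA_basis (corona G H).
have := minD _ (corona_generator_dominating _ _ _ hnbh genB).
rewrite -(leq_add2l (n * dimA H)) => /leq_trans; apply.
(* Compare vertex by vertex: membership of [v] in the dominating set costs 1, paid either by [v]
   itself in [B] or by the excess of its copy trace over [dimA H]. *)
rewrite card_corona_set -hn -sum_nat_const -sum1_card [X in _ + X]big_mkcond.
rewrite -big_split leq_sum // => v _; rewrite inE.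
have := dimA_leq _ _ (copy_trace_generator _ _ B v genB).
case: (v \in base_trace _ _ B) => /=; first by rewrite addnC leq_add2l.
by case: ltnP => //=; rewrite ?addn0 ?addn1.
Qed.
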